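(* Let $f\colon B^*\to B^*$ be a morphism prolongable on a letter $a\in B$ and let $g\colon B^*\to A^*$ be a morphism such that $g(f^\omega(a))$ is an infinite word. Let $p=\mathsf{p}(\mathsf{Mat}_f)$ and let $B'$ be the following sub-alphabet of $B$: $$B'=\{b\in B\mid g(f^{pn}(b))\neq\varepsilon\ \text{for all large enough } n\}.$$ Then there exist non-erasing morphisms $f'\colon B'^*\to B'^*$ and $g'\colon B'^*\to A^*$ such that $g(f^\omega(a))=g'(f'^\omega(a))$. More precisely, $f'$ is the restriction of $\kappa_{B,B\setminus B'}\circ f^p$ to $B'^*$, and $\mathsf{Mat}_{f'}=(\mathsf{Mat}_{f^p})_{B'}$.
   Context: Alphabets are finite; $A^*$ is the free monoid of finite words over $A$, with empty word $\varepsilon$, and $A^+=A^*\setminus\{\varepsilon\}$. $|w|$ is the length of $w$ and $|w|_a$ the number of occurrences of the letter $a$ in $w$. Morphisms are monoid morphisms, extended letterwise to infinite words; a morphism is non-erasing if the image of every letter is non-empty. A morphism $f\colon B^*\to B^*$ is prolongable on $a\in B$ if $f(a)=au$ for some $u\in B^+$ and $|f^n(a)|\to+\infty$; then $f^\omega(a)=\lim_{n\to\infty}f^n(a)$ denotes the infinite word having all $f^n(a)$ as prefixes. The incidence matrix $\mathsf{Mat}_f\in\mathbb{N}^{B\times B}$ of $f\colon B^*\to B^*$ is defined by $(\mathsf{Mat}_f)_{b,c}=|f(c)|_b$. For $C\subseteq B$, $(\mathsf{Mat}_f)_C$ is the sub-matrix of $\mathsf{Mat}_f$ with rows and columns indexed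 by $C$. For $C\subseteq B$, $\kappa_{B,C}\colon B^*\to(B\setminus C)^*$ is the morphism defined by $\kappa_{B,C}(b)=\varepsilon$ if $b\in C$ and $\kappa_{B,C}(b)=b$ otherwise. A non-negative square matrix $P$ is primitive if some power $P^k$, $k\ge1$, has only positive entries. For a non-negative square matrix $M$, $\mathsf{p}(M)$ denotes the least positive integer $p$ for which there exists a permutation matrix $T$ such that $T^{-1}M^pT$ is an upper (or lower) block triangular matrix in which each square diagonal block is either primitive or the $1\times1$ zero matrix (such a $p$ always exists). *)

(* Defs.v *)
From mathcomp Require Import all_boot all_order all_fingroup all_algebra.
From mathcomp Require Import boolp.
Set Implicit Arguments.
Unset Strict Implicit.
Unset Printing Implicit Defensive.
Import GRing.Theory.

(* Finite words over T are elements of [seq T]; infinite words are functions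
   [nat -> T]. *)

Section Words.
Variables S T : finType.

Definition word_morphism (h : seq S -> seq T) : Prop :=
  h [::] = [::] /\ forall u v, h (u ++ v) = h u ++ h v.

Definition nonerasing (h : seq S -> seq T) : Prop :=
  forall s, h [:: s] <> [::].

Definition tends_to_infinity (u : nat -> nat) : Prop :=
  forall L, exists N, forall n, N <= n -> L <= u n.

Definition inf_prefix (n : nat) (x : nat -> T) : seq T := mkseq x n.

Definition prefix_of_inf (w : seq T) (x : nat -> T) : Prop :=
  w = inf_prefix (size w) x.

End Words.

Definition prolongable (T : finType) (f : seq T -> seq T) (a : T) : Prop :=
  (exists2 u, u <> [::] & f [:: a] = a :: u) /\
  tends_to_infinity (fun n => size (iter n f [:: a])).

(* [omega_limit f a x] reads "x = f^omega(a)"; such an x exists and is unique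
   as soon as f is a morphism prolongable on a. *)
Definition omega_limit (T : finType) (f : seq T -> seq T) (a : T)
    (x : nat -> T) : Prop :=
  forall n, prefix_of_inf (iter n f [:: a]) x.

(* [inf_image h x y] reads "h(x) is an infinite word and h(x) = y", where h(x)
   is the concatenation of the images of the letters of x, i.e. the limit of
   the images of its prefixes.  If h erases all but finitely many positions of
   x, then h(x) is finite and no y satisfies this. *)
Definition inf_image (S T : finType) (h : seq S -> seq T)
    (x : nat -> S) (y : nat -> T) : Prop :=
  tends_to_infinity (fun n => size (h (inf_prefix n x))) /\
  forall n, prefix_of_inf (h (inf_prefix n x)) y.

(* The sub-alphabet C as an alphabet of its own; a word over [letters C] is
   viewed as a word over T through [map val]. *)
Definition letters (T : finType) (C : {set T}) : finType :=
  {b : T | b \in C}.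

(* kappa_{T,C}, which erases the letters of C; its value, a word over T \ C, is
   given here as a word over T. *)
Definition kappa (T : finType) (C : {set T}) (w : seq T) : seq T :=
  flatten [seq if b \in C then [::] else [:: b] | b <- w].

(* Matrices with rows and columns indexed by T are square matrices of size
   #|T|, through the enumeration of T. *)
Definition incidence_mx (T : finType) (f : seq T -> seq T) : 'M[nat]_#|T| :=
  \matrix_(i, j) count_mem (enum_val i) (f [:: enum_val j]).

Definition restrict_mx (T : finType) (M : 'M[nat]_#|T|) (C : {set T}) :
    'M[nat]_#|letters C| :=
  let idx (i : 'I_#|letters C|) : 'I_#|T| := enum_rank (val (enum_val i)) in
  mxsub idx idx M.

Definition primitive_mx n (P : 'M[nat]_n) : Prop :=
  exists2 k, 0 < k & forall i j, 0 < (P ^+ k)%R i j.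

(* N is block triangular (upper or lower) for the division of its indices into
   consecutive non-empty blocks of sizes d 0, ..., d (k - 1), each diagonal
   block being primitive or the 1 x 1 zero matrix. *)
Definition primitive_block_triangular n (N : 'M[nat]_n) : Prop :=
  exists (k : nat) (d : 'I_k -> nat) (dn : n = \sum_i d i),
    let N' := castmx (dn, dn) N in
    [/\ forall i, 0 < d i,
        (forall i j : 'I_k, j < i -> submxblock N' i j = 0%R) \/
        (forall i j : 'I_k, i < j -> submxblock N' i j = 0%R) &
        forall i, primitive_mx (submxblock N' i i) \/
                  d i = 1 /\ submxblock N' i i = 0%R].

(* The inverse of the permutation matrix of s is written [perm_mx (s^-1)%g]. *)
Definition primitive_exponent n (M : 'M[nat]_n) (p : nat) : Prop :=
  0 < p /\
  exists s : 'S_n, primitive_block_triangular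
    (perm_mx (s^-1)%g *m (M ^+ p)%R *m perm_mx s)%R.

(* [is_pM M p] reads "p = p(M)". *)
Definition is_pM n (M : 'M[nat]_n) (p : nat) : Prop :=
  primitive_exponent M p /\
  forall q, primitive_exponent M q -> p <= q.

Definition eventually_nonerased (B A : finType) (f : seq B -> seq B)
    (g : seq B -> seq A) (p : nat) : {set B} :=
  [set b | `[< exists N, forall n, N <= n ->
                 g (iter (p * n) f [:: b]) <> [::] >]].

(* Main.v *)
Require Import Defs.
From mathcomp Require Import all_boot all_order all_fingroup all_algebra.
From mathcomp Require Import boolp zify.
Set Implicit Arguments.
Unset Strict Implicit.
Unset Printing Implicit Defensive.

(** The primitive diagonal blocks of Mat_f^p make every long walk from a letter
    to an unerased letter prolongable to all larger lengths.  Hence there is a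
    K such that, for n >= K, whether g(f^(pn)(b)) is empty depends on b only,
    and B' is the set of letters for which it is not.  Taking g' = g o f^(pK)
    on B', a letter outside B' contributes nothing to g' and produces only
    letters outside B' under f^p, so that kappa intertwines f^p with f' and
    g' o f'^n = g o f^(p(K+n)) on words over B'.  *)

(** * Walks, seen as positive entries of powers of matrices over the naturals *)

Lemma mulmx_nat_gt0 m n q (M : 'M[nat]_(m, n)) (N : 'M[nat]_(n, q)) i j :
  reflect (exists l, 0 < M i l /\ 0 < N l j) (0 < (M *m N)%R i j).
Proof.
rewrite mxE lt0n.
change (reflect (exists l, 0 < M i l /\ 0 < N l j)
  (\sum_(l < n) M i l * N l j != 0)).
rewrite sum_nat_seq_neq0; apply: (iffP hasP) => [[l _]|[l [Ml Nl]]].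
  by rewrite /= muln_eq0 negb_or -!lt0n => /andP[Ml Nl]; exists l.
by exists l; rewrite ?mem_index_enum //= muln_eq0 negb_or -!lt0n Ml.
Qed.

Lemma expmxS_nat_gt0 n (M : 'M[nat]_n) k i j :
  reflect (exists l, 0 < M i l /\ 0 < (M ^+ k)%R l j) (0 < (M ^+ k.+1)%R i j).
Proof. by rewrite GRing.exprS; apply: mulmx_nat_gt0. Qed.

Lemma expmxD_nat_gt0 n (M : 'M[nat]_n) k m i l j :
  0 < (M ^+ k)%R i l -> 0 < (M ^+ m)%R l j -> 0 < (M ^+ (k + m))%R i j.
Proof.
by move=> Mil Mlj; rewrite GRing.exprD; apply/mulmx_nat_gt0; exists l.
Qed.

(** A positive power leaves no zero row in [P], so one more factor [P] keeps all entries
    positive. *)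
Lemma primitive_mx_ge n (P : 'M[nat]_n) : primitive_mx P ->
  exists k, forall m, k <= m -> forall i j, 0 < (P ^+ m)%R i j.
Proof.
case=> -[//|k] _ Pk; exists k.+1 => m /subnKC <-.
elim: (m - k.+1) => [|d IHd] i j; first by rewrite addn0; apply: Pk.
have /expmxS_nat_gt0[l [Pil _]] := Pk i i.
by rewrite addnS; apply/expmxS_nat_gt0; exists l.
Qed.

(** Every large length is demanded, not just one, so that a walk through [i] can be padded by any
    large amount. *)
Definition recurrent_index n (M : 'M[nat]_n) i :=
  exists k, forall m, k <= m -> 0 < (M ^+ m)%R i i.

(* A walk longer than the rank of its origin meets a recurrent index, where it
   can be prolonged to any larger length. *)
Lemma long_walk_prolongs n (M : 'M[nat]_n) (r : 'I_n -> nat) :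
    (forall i j, 0 < M i j -> recurrent_index M i \/ r j < r i) ->
  forall m i j, r i < m -> 0 < (M ^+ m)%R i j ->
    exists k, forall m', k <= m' -> 0 < (M ^+ m')%R i j.
Proof.
move=> rM; elim=> [//|m IHm] i j ri Mij.
have /expmxS_nat_gt0[l [Mil Mlj]] := Mij.
have [[k Mii]|rl] := rM _ _ Mil.
  (* A closed walk at [i] of length [m' - m.+1] is put in front of the given walk. *)
  exists (k + m.+1) => m' le_m'; rewrite -(@subnK m.+1 m'); last by lia.
  by apply: expmxD_nat_gt0 Mij; apply: Mii; lia.
have [|k Mk] := IHm l j _ Mlj; first by lia.
exists k.+1 => -[//|m'] le_m'; apply/expmxS_nat_gt0; exists l; split=> //.
exact: Mk.
Qed.

Lemma mxsub_expmx_gt0 m n (idx : 'I_m -> 'I_n) (M : 'M[nat]_n) k i j :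
  0 < (mxsub idx idx M ^+ k)%R i j -> 0 < (M ^+ k)%R (idx i) (idx j).
Proof.
elim: k i => [|k IHk] i.
  by rewrite !GRing.expr0 !mxE; case: eqVneq => [->|] //; rewrite eqxx.
case/expmxS_nat_gt0=> l []; rewrite mxE => Mil /IHk Mlj.
by apply/expmxS_nat_gt0; exists (idx l).
Qed.

(** Block numbers are monotone along positive entries. If [i] and [j] share a block, that diagonal
    block is non-zero, hence primitive. So the rank can be the block number, reversed in the upper
    triangular case. *)
Lemma primitive_block_triangular_rank n (N : 'M[nat]_n) :
  primitive_block_triangular N -> exists r : 'I_n -> nat,
    forall i j, 0 < N i j -> recurrent_index N i \/ r j < r i.
Proof.
case=> k [d [dn]]; subst n; rewrite castmx_id /= => -[_ Ntri Nblock].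
have block_of i j : 0 < N i j -> let q := tagnat.sig1 i in
    let q' := tagnat.sig1 j in submxblock N q q' <> 0%R.
  move=> Nij q q' /matrixP/(_ (tagnat.sig2 i) (tagnat.sig2 j)).
  by rewrite !mxE !tagnat.sig2K => Nij0; rewrite Nij0 in Nij.
have recN i j : 0 < N i j -> tagnat.sig1 i = tagnat.sig1 j ->
    recurrent_index N i.
  move=> Nij eq_ij; have := block_of _ _ Nij; rewrite -eq_ij /= => Nii.
  have [/primitive_mx_ge[m Pm]|[_ //]] := Nblock (tagnat.sig1 i).
  exists m => m' /Pm/(_ (tagnat.sig2 i) (tagnat.sig2 i)) /mxsub_expmx_gt0.
  by rewrite tagnat.sig2K.
case: Ntri => Ntri.
  exists (fun i => k - tagnat.sig1 i) => i j Nij.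
  case: (ltngtP (tagnat.sig1 i) (tagnat.sig1 j))
    => [lt_ij|lt_ji|/val_inj eq_ij].
  - by right; have := ltn_ord (tagnat.sig1 j); lia.
  - by case: (block_of _ _ Nij); apply: Ntri.
  - by left; apply: recN eq_ij.
exists (fun i => val (tagnat.sig1 i)) => i j Nij.
case: (ltngtP (tagnat.sig1 i) (tagnat.sig1 j))
  => [lt_ij|lt_ji|/val_inj eq_ij].
- by case: (block_of _ _ Nij); apply: Ntri.
- by right.
- by left; apply: recN eq_ij.
Qed.

Lemma primitive_exponent_walk n (M : 'M[nat]_n) p : primitive_exponent M p ->
  exists K, forall m i j, K <= m -> 0 < ((M ^+ p) ^+ m)%R i j ->
    exists k, forall m', k <= m' -> 0 < ((M ^+ p) ^+ m')%R i j.
Proof.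
case=> _ [s /primitive_block_triangular_rank]; set P := (M ^+ p)%R.
(* Conjugation by a permutation matrix only renames the indices, so ranks are transported along
   [s]. *)
have -> : (perm_mx s^-1 *m P *m perm_mx s)%R =
    mxsub (s^-1)%g (s^-1)%g P.
  rewrite -row_permE -{2}[s]invgK -col_permE.
  by apply/matrixP=> i j; rewrite !mxE.
(* A walk has to be strictly longer than the rank of its origin, hence the successor of the largest
   rank. *)
case=> r rP; exists (\max_(i < n) r (s i)).+1 => m i j le_m.
apply: (long_walk_prolongs (r := fun i => r (s i))); last first.
  by apply: leq_ltn_trans le_m; apply: (leq_bigmax (F := fun i => r (s i))).
move=> {}i {}j Pij; have := rP (s i) (s j); rewrite mxE !permK.
case/(_ Pij)=> [[k Pk]|]; last by right.
by left; exists k => m' /Pk /mxsub_expmx_gt0; rewrite permK.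
Qed.

(** * Word morphisms, incidence matrices and eventual erasure *)

Lemma word_morphism_comp (R S T : finType) (h : seq S -> seq T)
    (k : seq R -> seq S) :
  word_morphism h -> word_morphism k -> word_morphism (h \o k).
Proof.
move=> [h0 hD] [k0 kD]; split=> [|u v] /=; first by rewrite k0.
by rewrite kD hD.
Qed.

Lemma word_morphism_iter (T : finType) (h : seq T -> seq T) n :
  word_morphism h -> word_morphism (iter n h).
Proof.
by move=> hM; elim: n => [//|n]; apply: word_morphism_comp.
Qed.

Section WordMorphism.
Variables (S T : finType) (h : seq S -> seq T).
Hypothesis hM : word_morphism h.

Lemma word_morphism_cons b w : h (b :: w) = h [:: b] ++ h w.
Proof. by rewrite -cat1s hM.2. Qed.

Lemma word_morphism_mem c w :
  (c \in h w) = has (fun b => c \in h [:: b]) w.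
Proof.
elim: w => [|b w IHw]; first by rewrite hM.1.
by rewrite word_morphism_cons mem_cat IHw.
Qed.

Lemma word_morphism_eq0 w :
  h w = [::] <-> {in w, forall b, h [:: b] = [::]}.
Proof.
split=> [hw0 b bw|].
  case E: (h [:: b]) => [//|c u].
  have : c \in h w.
    by rewrite word_morphism_mem; apply/hasP; exists b; rewrite ?E ?mem_head.
  by rewrite hw0.
elim: w => [|b w IHw] h0; first by rewrite hM.1.
rewrite word_morphism_cons h0 ?mem_head //= IHw // => c cw.
by apply: h0; rewrite in_cons cw orbT.
Qed.

(** Linearity on Parikh vectors, through which composition of morphisms becomes product of incidence
    matrices. *)
Lemma word_morphism_count c w :
  count_mem c (h w) = \sum_b count_mem c (h [:: b]) * count_mem b w.
Proof.
elim: w => [|b w IHw].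
  by rewrite hM.1 big1 // => b _; rewrite muln0.
rewrite word_morphism_cons count_cat IHw /=.
rewrite (bigD1 b) // [in RHS](bigD1 b) //= eqxx mulnDr muln1 addnA.
congr (_ + _); apply: eq_bigr => d /negPf.
by rewrite eq_sym => ->.
Qed.

Lemma nonerasing_size w : nonerasing h -> size w <= size (h w).
Proof.
move=> hE; elim: w => [//|b w IHw]; rewrite word_morphism_cons size_cat /=.
case E: (h [:: b]) => [|c u]; first by case: (hE b).
by rewrite /= ltnS (leq_trans IHw) ?leq_addl.
Qed.

End WordMorphism.

Lemma incidence_mx_comp (T : finType) (h k : seq T -> seq T) :
  word_morphism h ->
  incidence_mx (h \o k) = (incidence_mx h *m incidence_mx k)%R.
Proof.
move=> hM; apply/matrixP=> i j; rewrite !mxE /= (word_morphism_count hM).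
rewrite (reindex (@enum_val T T)) /=; last exact/onW_bij/enum_val_bij.
by apply: eq_bigr => l _; rewrite !mxE.
Qed.

Lemma incidence_mx_iter (T : finType) (h : seq T -> seq T) n :
  word_morphism h -> incidence_mx (iter n h) = (incidence_mx h ^+ n)%R.
Proof.
move=> hM; elim: n => [|n IHn]; last first.
  by rewrite GRing.exprS -IHn; apply: incidence_mx_comp.
apply/matrixP=> i j; rewrite !mxE /= addn0 (inj_eq enum_val_inj) eq_sym.
by case: eqP.
Qed.

Lemma incidence_mx_gt0 (T : finType) (h : seq T -> seq T) b c :
  (0 < incidence_mx h (enum_rank c) (enum_rank b)) = (c \in h [:: b]).
Proof. by rewrite mxE !enum_rankK -has_count has_pred1. Qed.

(** By prolongation of long walks, non-erasure at one large time gives membership. The threshold of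
    the converse depends on the letter, and finiteness of [B] provides a common one. *)
Lemma eventually_nonerased_uniform (A B : finType) (f : seq B -> seq B)
    (g : seq B -> seq A) p (h := iter p f) :
    word_morphism f -> word_morphism g ->
    primitive_exponent (incidence_mx f) p ->
  exists K, forall b n, K <= n ->
    (b \in eventually_nonerased f g p) = (g (iter n h [:: b]) != [::]).
Proof.
move=> fM gM fp; have [K1 walk] := primitive_exponent_walk fp.
have hM : word_morphism h by apply: word_morphism_iter.
(* Rows index the produced letters: an occurrence of [c] in [iter n h [:: b]] is a walk of length
   [n] from [c] to [b]. *)
have mem_iter n b c : (c \in iter n h [:: b]) =
    (0 < ((incidence_mx f ^+ p) ^+ n)%R (enum_rank c) (enum_rank b)).
  by rewrite -incidence_mx_iter // -incidence_mx_iter // incidence_mx_gt0.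
have ev n b : K1 <= n -> g (iter n h [:: b]) <> [::] ->
    b \in eventually_nonerased f g p.
  move=> le_n nz; rewrite inE; apply/asboolP.
  have [c cw gc] : exists2 c, c \in iter n h [:: b] & g [:: c] <> [::].
    apply: contrapT => no_c; apply: nz; apply/(word_morphism_eq0 gM) => c cw.
    by apply: contrapT => gc; apply: no_c; exists c.
  move: cw; rewrite mem_iter => /(walk _ _ _ le_n)[k walk_k].
  exists k => m /walk_k; rewrite -mem_iter mulnC iterM => cw.
  by move=> /(word_morphism_eq0 gM)/(_ c cw).
have /choice[N HN] : forall b, exists N, b \in eventually_nonerased f g p ->
    forall n, N <= n -> g (iter n h [:: b]) <> [::].
  move=> b; case: (boolP (b \in _)) => [|_]; last by exists 0.
  rewrite inE => /asboolP[N HN]; exists N => _ n /HN.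
  by rewrite mulnC iterM.
exists (maxn K1 (\max_b N b)) => b n; rewrite geq_max => /andP[le1 le2].
apply/idP/idP => [bB|/eqP]; last exact: ev.
by apply/eqP; apply: HN bB _ _; apply: leq_trans le2; apply: leq_bigmax.
Qed.

(** * Infinite words generated by prolongable morphisms *)

Lemma prefix_of_inf_catl (T : finType) (u v : seq T) x :
  prefix_of_inf (u ++ v) x -> prefix_of_inf u x.
Proof.
rewrite /prefix_of_inf /inf_prefix /mkseq => /(congr1 (take (size u))).
rewrite take_size_cat // -map_take take_iota size_cat.
by rewrite (minn_idPl (leq_addr _ _)).
Qed.

Section OmegaLimit.
Variables (T : finType) (f : seq T -> seq T) (a : T).
Hypotheses (fM : word_morphism f) (fa : prolongable f a).

(** From [f [:: a] = a :: u], each iterate is the previous one followed by the iterated image of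
    [u]. *)
Lemma iter_prolongable_prefix m n :
  prefix (iter m f [:: a]) (iter (m + n) f [:: a]).
Proof.
case: fa => [[u _ fau] _].
elim: n => [|n IHn]; first by rewrite addn0 prefix_refl.
apply: prefix_trans IHn _; rewrite addnS iterSr fau -(cat1s a u).
by rewrite (word_morphism_iter _ fM).2 prefix_prefix.
Qed.

Lemma prolongable_omega_limit : exists x, omega_limit f a x.
Proof.
have [_ size_oo] := fa.
have /choice[m lt_m] : forall i, exists m, i < size (iter m f [:: a]).
  by move=> i; have [N /(_ N (leqnn N))] := size_oo i.+1; exists N.
(* Position [i] is read in an iterate longer than [i], so the default [a] is never reached. *)
exists (fun i => nth a (iter (m i) f [:: a]) i) => n.
apply: (@eq_from_nth _ a) => [|i lt_i]; first by rewrite size_mkseq.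
rewrite nth_mkseq //.
have nth_max k k' : i < size (iter k f [:: a]) ->
    nth a (iter (k + k') f [:: a]) i = nth a (iter k f [:: a]) i.
  move=> lt_k; have /prefixP[v ->] := iter_prolongable_prefix k k'.
  by rewrite nth_cat lt_k.
(* Both iterates are compared with the one of exponent [n + m i]. *)
by rewrite -(nth_max _ (m i)) // addnC nth_max.
Qed.

End OmegaLimit.

Lemma nonerasing_prolongable (T : finType) (f : seq T -> seq T) a u :
  word_morphism f -> nonerasing f -> u <> [::] -> f [:: a] = a :: u ->
  prolongable f a.
Proof.
move=> fM fE u0 fau; split; first by exists u.
(* The tail [v] becomes [u ++ f v], where [u] is non-empty and [f v] is at least as long as [v]. *)
suff grow n : exists2 v, iter n f [:: a] = a :: v & n <= size v.
  by move=> L; exists L => n le_n; have [v -> /=] := grow n; lia.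
elim: n => [|n [v IHv le_v]]; first by exists [::].
rewrite iterS IHv word_morphism_cons // fau; exists (u ++ f v) => //.
rewrite size_cat; have := nonerasing_size fM v fE.
by case: u u0 {fau} => //= *; lia.
Qed.

(** * Restriction to the letters that survive under the coding *)

Section Restriction.
Variables (A B : finType) (h : seq B -> seq B) (g : seq B -> seq A).
Variables (C : {set B}) (K : nat).
Hypotheses (hM : word_morphism h) (gM : word_morphism g).
Hypothesis CK : forall b n, K <= n -> (b \in C) = (g (iter n h [:: b]) != [::]).

(** This is [kappa (~: C)] with values typed as words over the sub-alphabet. *)
Definition keep (w : seq B) : seq (letters C) := pmap insub w.

Definition restrict_morphism (w : seq (letters C)) := keep (h (map val w)).

(** The [K] preliminary iterations make the coding non-erasing, as [CK] applies from [K] on. *)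
Definition pullback_coding (w : seq (letters C)) := g (iter K h (map val w)).

Let f' := restrict_morphism.
Let g' := pullback_coding.

Lemma map_val_keep w : map val (keep w) = kappa (~: C) w.
Proof.
rewrite /keep /kappa; elim: w => //= b w IHw; rewrite inE.
by case: insubP => [c -> <-|/negPf->] /=; rewrite IHw.
Qed.

Lemma keep_map_val w : keep (map val w) = w.
Proof. by rewrite /keep; elim: w => //= b w ->; rewrite valK. Qed.

Lemma keep_cat u v : keep (u ++ v) = keep u ++ keep v.
Proof. exact: pmap_cat. Qed.

Lemma restrict_morphismM : word_morphism f'.
Proof.
split; first by rewrite /f' /restrict_morphism hM.1.
by move=> u v; rewrite /f' /restrict_morphism map_cat hM.2 keep_cat.
Qed.

Lemma pullback_codingM : word_morphism g'.
Proof.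
have [gh0 ghD] := word_morphism_comp gM (word_morphism_iter K hM).
split=> [|u v]; first exact: gh0.
by rewrite /g' /pullback_coding map_cat; apply: ghD.
Qed.

(** Both sides can be tested letter by letter, where [CK] equates them. *)
Lemma keep_eq0 w n : K <= n -> keep w = [::] <-> g (iter n h w) = [::].
Proof.
move=> le_n; have ghM := word_morphism_comp gM (word_morphism_iter n hM).
rewrite (word_morphism_eq0 ghM); split=> [w0 b bw|w0].
  apply/eqP; rewrite -[_ == _]negbK -(CK _ le_n); apply/negP=> bC.
  have : Sub b bC \in keep w by rewrite mem_pmap_sub.
  by rewrite w0.
case E: (keep w) => [//|c u].
have : c \in keep w by rewrite E mem_head.
rewrite mem_pmap_sub => /w0 /eqP; rewrite -[_ == _]negbK -(CK _ le_n).
by rewrite (valP c).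
Qed.

Lemma keep_morph w : keep (h w) = f' (keep w).
Proof.
elim: w => [|b w IHw]; first by rewrite restrict_morphismM.1 hM.1.
rewrite word_morphism_cons // keep_cat IHw -(cat1s b w) keep_cat.
rewrite restrict_morphismM.2.
congr (_ ++ _); rewrite /keep /=; case: insubP => [c _ <- //|/=].
(* Here [b] is outside [C]. Reading [CK] at [K.+1] leaves [K] iterations for [h [:: b]], whose
   letters are therefore all outside [C]. *)
rewrite (CK _ (leqnSn K)) negbK iterSr => /eqP b0.
by rewrite restrict_morphismM.1; apply/(keep_eq0 _ (leqnn K)).
Qed.

Lemma keep_iter n w : keep (iter n h w) = iter n f' (keep w).
Proof. by elim: n => //= n <-; rewrite keep_morph. Qed.

Lemma pullback_coding_keep w : g' (keep w) = g (iter K h w).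
Proof.
rewrite /g' /pullback_coding map_val_keep.
have ghM := word_morphism_comp gM (word_morphism_iter K hM).
elim: w => [//|b w IHw]; rewrite [RHS](word_morphism_cons ghM) /= -IHw.
rewrite /kappa /= inE; case: ifP => [|_]; last exact: (word_morphism_cons ghM).
by rewrite (CK _ (leqnn K)) negbK => /eqP->.
Qed.

Lemma pullback_coding_nonerasing : nonerasing g'.
Proof.
by move=> b; apply/eqP; rewrite -(CK (val b) (leqnn K)); apply: valP.
Qed.

(** An empty image of [b] would make [g] erase the iterate [K.+1] of [b], against [b] being in
    [C]. *)
Lemma restrict_morphism_nonerasing : nonerasing f'.
Proof.
move=> b /(keep_eq0 _ (leqnn K)) /eqP.
by rewrite -iterSr -[_ == _]negbK -(CK (val b) (leqnSn K)) (valP b).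
Qed.

(** Erasing letters outside [C] leaves the counts of letters of [C] unchanged. *)
Lemma incidence_restrict_morphism :
  incidence_mx f' = restrict_mx (incidence_mx h) C.
Proof.
apply/matrixP=> i j; rewrite !mxE !enum_rankK /f' /restrict_morphism /=.
move: (enum_val i) (h _) => c; rewrite /keep; elim=> //= b w <-.
case: insubP => [d _ <- //|nbC] /=; case: eqP => // eq_bc.
by rewrite eq_bc (valP c) in nbC.
Qed.

Variables (a : B) (x : nat -> B) (y : nat -> A).
Hypotheses (hx : omega_limit h a x) (gy : inf_image g x y).
Hypothesis ha_oo : tends_to_infinity (fun n => size (iter n h [:: a])).

Lemma coding_iter_tends_to_infinity :
  tends_to_infinity (fun n => size (g (iter n h [:: a]))).
Proof.
move=> L; have [N HN] := gy.1 L; have [N' HN'] := ha_oo N.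
by exists N' => n /HN'/HN; rewrite -hx.
Qed.

Lemma omega_limit_restriction : exists (a' : letters C) (x' : nat -> letters C),
  [/\ val a' = a, prolongable f' a', omega_limit f' a' x' & inf_image g' x' y].
Proof.
have aC : a \in C.
  have [N HN] := coding_iter_tends_to_infinity 1.
  rewrite (CK _ (leq_maxl K N)) -size_eq0 -lt0n; apply: HN.
  exact: leq_maxr.
pose a' : letters C := Sub a aC.
have keep_a : keep [:: a] = [:: a'] by apply: (keep_map_val [:: a']).
have g'_iter n : g' (iter n f' [:: a']) = g (iter (K + n) h [:: a]).
  by rewrite -keep_a -keep_iter pullback_coding_keep iterD.
have x0 : x 0 = a by have := hx 0; rewrite /prefix_of_inf /= => -[].
(* The word [h [:: a]] is a prefix of [x], which starts with [a]; it is non-empty because [f'] is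
   non-erasing. *)
have [u hau] : exists u, h [:: a] = a :: u.
  have := hx 1; rewrite /prefix_of_inf /=; case E: (h [:: a]) => [|c u].
    have /(_ a') := restrict_morphism_nonerasing.
    by rewrite /f' /restrict_morphism /= E.
  by rewrite /inf_prefix /mkseq /= x0 => -[-> _]; exists u.
have f'a : f' [:: a'] = a' :: keep u.
  by rewrite /f' /restrict_morphism /= hau -(cat1s a u) keep_cat keep_a.
(* Otherwise [f'] fixes [a'], and the words [g (iter (K + n) h [:: a])] would be constant instead of
   growing without bound. *)
have u0 : keep u <> [::].
  move=> u0; rewrite u0 in f'a.
  have f'_iter n : iter n f' [:: a'] = [:: a'] by elim: n => //= n ->.
  have [N HN] := coding_iter_tends_to_infinity (size (g' [:: a'])).+1.
  have := HN (K + N) (leq_addl _ _).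
  by rewrite -g'_iter f'_iter ltnn.
have f'a_prol : prolongable f' a'.
  exact: nonerasing_prolongable restrict_morphismM
    restrict_morphism_nonerasing u0 f'a.
have [x' hx'] := prolongable_omega_limit restrict_morphismM f'a_prol.
exists a', x'; split=> //; split=> [L|n].
  exists L => n le_n; apply: leq_trans le_n _.
  rewrite -[leqLHS](size_mkseq x').
  exact: nonerasing_size pullback_codingM _ pullback_coding_nonerasing.
(* A prefix of [x'] lies in some [iter m f' [:: a']], whose image under [g'] is the image under [g]
   of a prefix of [x], hence a prefix of [y]. *)
have [m /(_ m (leqnn m)) le_m] := f'a_prol.2 n.
have [v f'm] : exists v, iter m f' [:: a'] = inf_prefix n x' ++ v.
  rewrite hx' /inf_prefix /mkseq -(subnKC le_m) iotaD map_cat.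
  by eexists.
apply: (@prefix_of_inf_catl _ _ (g' v)).
by rewrite -pullback_codingM.2 -f'm g'_iter hx; apply: gy.2.
Qed.

End Restriction.

Theorem proposition40 (A B : finType) (f : seq B -> seq B) (a : B)
    (g : seq B -> seq A) (x : nat -> B) (y : nat -> A) (p : nat) :
  word_morphism f -> prolongable f a -> word_morphism g ->
  omega_limit f a x -> inf_image g x y ->
  is_pM (incidence_mx f) p ->
  let B' := eventually_nonerased f g p in
  exists (f' : seq (letters B') -> seq (letters B'))
         (g' : seq (letters B') -> seq A),
    [/\ word_morphism f' /\ nonerasing f',
        word_morphism g' /\ nonerasing g',
        exists (a' : letters B') (x' : nat -> letters B'),
          [/\ val a' = a, prolongable f' a',
              omega_limit f' a' x' & inf_image g' x' y],
        forall w : seq (letters B'),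
          map val (f' w) = kappa (~: B') (iter p f (map val w)) &
        incidence_mx f' = restrict_mx (incidence_mx (iter p f)) B'].
Proof.
move=> fM [_ fa_oo] gM fx gy [fp _] B'.
have hM := word_morphism_iter p fM.
have [K B'K] := eventually_nonerased_uniform fM gM fp.
have hx : omega_limit (iter p f) a x by move=> n; rewrite -iterM.
have ha_oo : tends_to_infinity (fun n => size (iter n (iter p f) [:: a])).
  (* As [p] is positive, [n * p] is at least [n]. *)
  move=> L; have [N HN] := fa_oo L; exists N => n le_n.
  by rewrite -iterM; apply: HN; apply: leq_trans le_n (leq_pmulr _ fp.1).
exists (restrict_morphism (iter p f) (C := B')),
  (pullback_coding (iter p f) g K (C := B')).
split.
- split; first exact: restrict_morphismM.
  exact: (restrict_morphism_nonerasing hM gM B'K).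
- split; first exact: pullback_codingM.
  exact: (pullback_coding_nonerasing B'K).
- exact: (omega_limit_restriction hM gM B'K hx gy ha_oo).
- by move=> w; apply: map_val_keep.
- exact: incidence_restrict_morphism.
Qed.
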